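(* Let $\mathbf{p}=(p_1,\dots,p_n)$ be a probability distribution with all $p_i>0$, $Z>0$ an integer, and $g:(0,\infty)\to\mathbb{R}$ convex with $g(1)=0$. Initialize, for each $i$, $M_i:=\lfloor Zp_i\rfloor$ if $g(\lfloor Zp_i\rfloor/(Zp_i))\le g((\lfloor Zp_i\rfloor+1)/(Zp_i))$ and $M_i:=\lfloor Zp_i\rfloor+1$ otherwise. Define $\epsilon(\mathbf{W},i,\delta):=p_i[g((W_i+\delta)/(Zp_i))-g(W_i/(Zp_i))]$ for $\delta\in\{+1,-1\}$ (or $\infty$ if $W_i+\delta\notin\{0,\dots,Z\}$). Run the loop: choose $(j,j')$ with $j\ne j'$ minimizing $\epsilon(\mathbf{M},j,+1)+\epsilon(\mathbf{M},j',-1)$; if this value is negative, set $M_j\gets M_j+1$, $M_{j'}\gets M_{j'}-1$ and repeat; otherwise stop. Then there is no index $j\in\{1,\dots,n\}$ such that $M_j$ is incremented at some iteration of this loop and decremented at a later iteration.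
   Context: The value $g(0)$ is understood as $\lim_{s\to0^+}g(s)\in\mathbb{R}\cup\{+\infty\}$. Ties in the minimization are broken arbitrarily. *)

(* Defs.v *)
From mathcomp Require Import all_boot all_order all_algebra.
From mathcomp Require Import all_classical all_reals all_analysis.
Import Order.TTheory GRing.Theory Num.Theory.
Import numFieldNormedType.Exports.

Set Implicit Arguments.
Unset Strict Implicit.
Unset Printing Implicit Defensive.

Local Open Scope classical_set_scope.
Local Open Scope ring_scope.

(* A function (0, oo) -> R is represented by a total g : R -> R; all the
   notions below only use its values at positive reals. [at0 g] is g on (0, oo)
   together with g(0) := lim_{s -> 0+} g(s), which may be +oo. *)
Definition at0 {R : realType} (g : R -> R) (s : R) : \bar R :=
  if s == 0 then lim ((g t)%:E @[t --> 0^'+]) else (g s)%:E.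

Section greedy.
Context {R : realType} {n : nat}.
Variables (p : 'I_n -> R) (Z : nat) (g : R -> R).

(* g (w / (Z p_i)) *)
Definition gratio (i : 'I_n) (w : int) : \bar R :=
  at0 g (w%:~R / (Z%:R * p i)).

Definition init_alloc : {ffun 'I_n -> int} :=
  [ffun i => let f := Num.floor (Z%:R * p i) in
             if (gratio i f <= gratio i (f + 1))%E then f else f + 1].

(* The difference of extended reals is never of the form oo - oo at a state
   reached from [init_alloc]: when g(0) = +oo, all its entries are positive. *)
Definition eps (W : {ffun 'I_n -> int}) (i : 'I_n) (d : int) : \bar R :=
  if (0 <= W i + d) && (W i + d <= Z%:Z)
  then ((p i)%:E * (gratio i (W i + d) - gratio i (W i)))%E
  else +oo%E.

Definition exchange_cost (W : {ffun 'I_n -> int}) (j j' : 'I_n) : \bar R :=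
  (eps W j 1 + eps W j' (-1))%E.

Definition exchange (W : {ffun 'I_n -> int}) (j j' : 'I_n) :
    {ffun 'I_n -> int} :=
  [ffun i => if i == j then W i + 1 else if i == j' then W i - 1 else W i].

(* One iteration of the loop. It is a relation: any minimizing pair is allowed,
   so that ties are broken arbitrarily. *)
Definition loop_iter (W : {ffun 'I_n -> int}) (j j' : 'I_n)
    (W' : {ffun 'I_n -> int}) : Prop :=
  [/\ j != j',
      forall k k' : 'I_n, k != k' ->
        (exchange_cost W j j' <= exchange_cost W k k')%E,
      (exchange_cost W j j' < 0)%E
    & W' = exchange W j j'].

(* The first T iterations of an execution of the loop, numbered from 0:
   iteration t goes from state M t to state M t.+1, incrementing the entry j t
   and decrementing the entry j' t. The values of j, j' at t >= T, and of M at
   t > T, are irrelevant. *)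
Definition loop_run (T : nat) (M : nat -> {ffun 'I_n -> int})
    (j j' : nat -> 'I_n) : Prop :=
  M 0%N = init_alloc /\
  forall t : nat, (t < T)%N -> loop_iter (M t) (j t) (j' t) (M t.+1).

End greedy.

(* Main.v *)
(* The cost of the increment chosen at an iteration is the least increment cost
   of the current state, and by convexity of g it never decreases along the run.
   Once k has been incremented, undoing this costs at least minus the current
   least increment cost, so decrementing k is never part of an improving
   exchange. *)
Require Import Defs.
From mathcomp Require Import all_boot all_order all_algebra.
From mathcomp Require Import all_classical all_reals all_analysis.
From mathcomp Require Import zify ring lra.
Import Order.TTheory GRing.Theory Num.Theory.
Import numFieldNormedType.Exports.
Local Open Scope classical_set_scope.
Local Open Scope ring_scope.

(** * Chords and the limit at 0 of a convex function *)

Lemma convex_pos_chord (R : realType) (g : R -> R) (x y z : R) :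
  convex_function (`]0, +oo[ : set R) g -> 0 < x -> x < y -> y < z ->
  (z - x) * g y <= (z - y) * g x + (y - x) * g z.
Proof.
move=> g_convex x0 xy yz.
have zx0 : 0 < z - x by lra.
pose t := (z - y) / (z - x).
have t01 : 0 <= t <= 1.
  by rewrite /t divr_ge0 ?ler_pdivrMr ?mul1r//=; lra.
have : g (t * x + (1 - t) * z) <= t * g x + (1 - t) * g z.
  apply: (g_convex (Itv01 (andP t01).1 (andP t01).2) x z);
    by rewrite inE/= in_itv/= andbT//; lra.
have -> : t * x + (1 - t) * z = y by rewrite /t; field; lra.
rewrite -(ler_pM2l zx0) => /le_trans; apply.
by rewrite le_eqVlt; apply/orP; left; apply/eqP; rewrite /t; field; lra.
Qed.

(** The bound is the value at 0 of the line through the points of the graph over [x] and [2 * x]: it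
    is the convexity inequality at 0, [x], [2 * x] carried to the limit, and it keeps the limit
    above [-oo]. *)
Lemma convex_pos_cvg0 (R : realType) (g : R -> R) (x : R) :
  convex_function (`]0, +oo[ : set R) g -> 0 < x ->
  exists2 l : \bar R, (g t)%:E @[t --> 0^'+] --> l &
    ((2 * g x - g (2 * x))%:E <= l)%E.
Proof.
move=> g_convex x0.
have x2 : x < 2 * x by lra.
(* Subtracting the chord through x and 2x makes g nonnegative and nonincreasing
   on (0, x). *)
pose m := (g (2 * x) - g x) / x.
pose L t := g x + (t - x) * m.
pose h t := g t - L t.
have h_chord (a b c : R) : 0 < a -> a < b -> b < c ->
    (c - a) * h b <= (c - b) * h a + (b - a) * h c.
  move=> a0 ab bc; have := convex_pos_chord _ _ _ _ _ g_convex a0 ab bc.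
  rewrite /h /L; lra.
have hx : h x = 0 by rewrite /h /L; ring.
have h2x : h (2 * x) = 0 by rewrite /h /L /m; field; lra.
have h_ge0 (s : R) : 0 < s -> s < x -> 0 <= h s.
  (* The chord inequality at [s], [x], [2 * x], where [h] vanishes at the last two points. *)
  move=> s0 sx; have := h_chord _ _ _ s0 sx x2.
  rewrite hx h2x !mulr0 addr0 pmulr_rge0//; lra.
pose H := ereal_sup [set (h t)%:E | t in `]0, x[%classic].
have h_cvg : (h t)%:E @[t --> 0^'+] --> H.
  apply: (nonincreasing_at_right_cvge (BLeft x)) => [|s t].
    by rewrite bnd_simp.
  rewrite !in_itv/= => /andP[s0 sx] /andP[t0 tx].
  rewrite le_eqVlt => /orP[/eqP ->//|st].
  rewrite lee_fin -(@ler_pM2l _ (x - s)) ?subr_gt0//.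
  (* As [h x = 0], the chord inequality at [s], [t], [x] bounds [(x - s) * h t] by [(x - t) * h s],
     and [h s] is nonnegative. *)
  have := h_chord _ _ _ s0 st tx; have := h_ge0 _ s0 sx.
  rewrite hx mulr0 addr0; nra.
have sup_ge0 : (0 <= H)%E.
  apply: (@le_trans _ _ (h (x / 2))%:E).
    by rewrite lee_fin h_ge0//; lra.
  apply: ereal_sup_ubound; exists (x / 2) => //=.
  by rewrite in_itv/=; apply/andP; split; lra.
have L_cvg : (L t)%:E @[t --> 0^'+] --> (L 0)%:E.
  apply: cvg_EFin; first by near=> t.
  apply: cvg_at_right_filter.
  apply: cvgD; first exact: cvg_cst.
  apply: cvgMr_tmp; apply: cvgB; last exact: cvg_cst.
  exact: cvg_id.
exists (H + (L 0)%:E)%E.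
  have -> : (fun t => (g t)%:E) = (fun t => ((h t)%:E + (L t)%:E)%E).
    by apply/funext => t; rewrite /h -EFinD subrK.
  apply: cvgeD => //.
  by rewrite fin_num_adde_defl.
have -> : 2 * g x - g (2 * x) = L 0 by rewrite /L /m; field; lra.
by rewrite leeDr.
Unshelve. all: by end_near.
Qed.

(** * Marginal costs of a single entry *)

Section marginals.
Context {R : realType} {n : nat}.
Variables (p : 'I_n -> R) (Z : nat) (g : R -> R).
Hypothesis p_gt0 : forall i, 0 < p i.
Hypothesis Z_gt0 : (0 < Z)%N.
Hypothesis g_convex : convex_function (`]0, +oo[ : set R) g.

Implicit Types (W V : {ffun 'I_n -> int}) (i : 'I_n) (w : int).

Local Notation gratio := (gratio p Z g).
Local Notation eps := (eps p Z g).

Lemma Zp_gt0 i : 0 < Z%:R * p i.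
Proof. by rewrite mulr_gt0// ltr0n. Qed.

Lemma gratio0 i : gratio i 0 = lim ((g t)%:E @[t --> 0^'+]).
Proof. by rewrite /Defs.gratio /at0 mulr0z mul0r eqxx. Qed.

Lemma gratio_fin i w : 0 < w -> gratio i w \is a fin_num.
Proof.
move=> w0; rewrite /Defs.gratio /at0 ifF//.
by rewrite gt_eqF// divr_gt0// ?ltr0z// Zp_gt0.
Qed.

Lemma gratio_ltNy i w : 0 <= w -> (-oo < gratio i w)%E.
Proof.
move=> w_ge0; have [->|w_neq0] := eqVneq w 0; last have w0 : 0 < w by lia.
  rewrite gratio0.
  have [l gl] := convex_pos_cvg0 _ _ _ g_convex ltr01.
  rewrite (cvg_lim _ gl)//; apply: lt_le_trans; exact: ltNyr.
by rewrite ltNye_eq gratio_fin.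
Qed.

(** [gratio i w] stands alone on the right because it may be [+oo] at [w = 0]; the other two values
    are at positive arguments, so [fine] loses nothing. *)
Lemma gratio_convex i w : 0 <= w ->
  ((fine (gratio i (w + 1)) * 2 - fine (gratio i (w + 2)))%:E <= gratio i w)%E.
Proof.
have Zp0 := Zp_gt0 i.
have gpos v : 0 < v -> gratio i v = (g (v%:~R / (Z%:R * p i)))%:E.
  move=> v0; rewrite /Defs.gratio /at0 ifF//.
  by rewrite gt_eqF// divr_gt0// ltr0z.
move=> w_ge0; have [->|w_neq0] := eqVneq w 0; last have w0 : 0 < w by lia.
  rewrite gratio0 !add0r !gpos//=.
  have x0 : 0 < (1%:~R / (Z%:R * p i) : R) by rewrite divr_gt0.
  have [l gl] := convex_pos_cvg0 _ _ _ g_convex x0.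
  by rewrite (cvg_lim _ gl)// div1r mulrC.
rewrite !gpos ?addr_gt0// lee_fin /=.
pose c := (Z%:R * p i)^-1; have c0 : 0 < c by rewrite invr_gt0.
have wR : 0 < (w%:~R : R) by rewrite ltr0z.
rewrite !rmorphD /= -/c.
have h1 : 0 < w%:~R * c by rewrite mulr_gt0.
have h2 : w%:~R * c < (w%:~R + 1%:~R) * c by rewrite ltr_pM2r//; lra.
have h3 : (w%:~R + 1%:~R) * c < (w%:~R + 2%:~R) * c by rewrite ltr_pM2r//; lra.
have := convex_pos_chord _ _ _ _ _ g_convex h1 h2 h3.
rewrite -!mulrBl -(@ler_pM2l _ c)//.
have -> : w%:~R + 2%:~R - w%:~R = 2 :> R by ring.
have -> : w%:~R + 2%:~R - (w%:~R + 1%:~R) = 1 :> R by ring.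
have -> : w%:~R + 1%:~R - w%:~R = 1 :> R by ring.
lra.
Qed.

(* At such a state no difference in [eps] is oo - oo. *)
Definition finite_state W := forall i, 0 <= W i /\ gratio i (W i) \is a fin_num.

Lemma finite_init : finite_state (init_alloc p Z g).
Proof.
move=> i; rewrite /init_alloc ffunE.
set f := Num.floor _.
have f0 : 0 <= f by rewrite floor_ge0 ltW// Zp_gt0.
have f1 : 0 < f + 1 by rewrite ltr_wpDl.
case: ifPn => fle; last by split; [exact: ltW | exact: gratio_fin].
(* Rounding down is kept only if its value is at most the finite value at [f + 1], which excludes an
   infinite g(0). *)
split=> //; rewrite fin_real// gratio_ltNy//= (le_lt_trans fle)//.
by rewrite ltey_eq gratio_fin.
Qed.

Lemma eps_ltNy W i d : finite_state W -> (-oo < eps W i d)%E.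
Proof.
move=> fW; have [_ Wfin] := fW i; rewrite /Defs.eps; case: ifP => // /andP[Wd _].
have := gratio_ltNy i _ Wd; move: (gratio i (W i + d)) Wfin => [r| |]//=.
  by case: (gratio i (W i)) => // s _ _; rewrite ltNyr.
case: (gratio i (W i)) => // s _ _.
by rewrite /= mulry gtr0_sg// mul1e.
Qed.

(** When the way back is allowed the two costs cancel; otherwise it costs [+oo], which can occur as
    [finite_state] does not bound [W i] by [Z]. Finiteness of the first cost keeps [V i] away from
    an infinite value, from which the way back would cost [-oo]. *)
Lemma eps_reverse W V i d : finite_state W -> V i = W i + d ->
  (eps W i d < +oo)%E -> (0 <= eps W i d + eps V i (- d))%E.
Proof.
move=> fW Vi eltoo; have := eps_ltNy _ i d fW; have [_ Wfin] := fW i.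
move: eltoo; rewrite /Defs.eps Vi addrK; case: ifP => // _.
case: (gratio i (W i)) Wfin => // s _; have p0 := p_gt0 i.
case: (gratio i (W i + d)) => [r| |] //=.
- move=> _ _; case: ifP => _; last exact: leey.
  by rewrite lee_fin; lra.
- by rewrite addye// mulry gtr0_sg// mul1e.
- by rewrite addNye mulrNy gtr0_sg// mul1e.
Qed.

(** Slopes of a convex function do not decrease; the cutoff at [Z] agrees with this, because it
    makes the second increment infinite whenever it does so for the first. *)
Lemma eps_incr W V i : finite_state W -> V i = W i + 1 ->
  (eps W i 1 <= eps V i 1)%E.
Proof.
move=> fW Vi; have [W0 Wfin] := fW i; have p0 := p_gt0 i.
have := gratio_convex i _ W0; rewrite /Defs.eps Vi -addrA (_ : 1 + 1 = 2)//.
have := gratio_fin i (W i + 1) ltac:(lia).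
have := gratio_fin i (W i + 2) ltac:(lia).
case: (gratio i (W i)) Wfin => // s _.
case: (gratio i (W i + 2)) => // u _; case: (gratio i (W i + 1)) => // r _ /=.
rewrite lee_fin => conv_rsu; case: (ifP (_ && (W i + 2 <= _))); last first.
  by rewrite leey.
move=> /andP[W2 W2Z]; rewrite ifT; last by apply/andP; split; lia.
by rewrite lee_fin ler_pM2l//; lra.
Qed.

(** Convexity at [W i - 1], [W i], [W i + 1]: stepping up costs at least what stepping down saves.
    If stepping down is out of range or meets an infinite g(0), it costs [+oo]. *)
Lemma eps_incr_decr_ge0 W i : finite_state W ->
  (0 <= eps W i 1 + eps W i (-1))%E.
Proof.
move=> fW; have e1 := eps_ltNy _ i 1 fW.
have [W0 Wfin] := fW i; have p0 := p_gt0 i.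
have [Wd|Wd] := boolP (0 <= W i - 1); last first.
  have -> : eps W i (-1) = +oo%E by rewrite /Defs.eps (negbTE Wd).
  by move: e1; case: (eps W i 1) => // *; exact: leey.
have := gratio_convex i _ Wd; have := gratio_fin i (W i + 1) ltac:(lia).
move: e1; rewrite subrK -addrA (_ : -1 + 2 = 1)// /Defs.eps.
case: (gratio i (W i)) Wfin => // s _.
case: (gratio i (W i - 1)) => [u| |] // e1.
  move: e1; case: (gratio i (W i + 1)) => // r _ _; rewrite lee_fin /= => conv_usr.
  case: ifP => _; case: ifP => _; try exact: leey.
  by rewrite lee_fin; nra.
have -> : ((p i)%:E * (+oo - s%:E) = +oo)%E.
  by rewrite addye// mulry gtr0_sg// mul1e.
rewrite if_same; move: e1; case: ifP => _ e1 _ _; last exact: leey.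
by rewrite addey// -ltNye.
Qed.

(** * Effect of one iteration *)

Lemma exchange_cost_fin W k k' : finite_state W ->
  (exchange_cost p Z g W k k' < 0)%E ->
  eps W k 1 \is a fin_num /\ eps W k' (-1) \is a fin_num.
Proof.
move=> fW; rewrite /exchange_cost.
have := eps_ltNy _ k 1 fW; have := eps_ltNy _ k' (-1) fW.
by case: (eps W k 1); case: (eps W k' (-1)).
Qed.

Lemma eps_fin_step W V i d : finite_state W -> V i = W i + d ->
  eps W i d \is a fin_num -> 0 <= V i /\ gratio i (V i) \is a fin_num.
Proof.
move=> fW ->; have [_ Wfin] := fW i; rewrite /Defs.eps.
case: ifP => // /andP[Wd _] e_fin; split=> //; have := gratio_ltNy i _ Wd.
move: e_fin; case: (gratio i (W i)) Wfin => // s _.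
case: (gratio i (W i + d)) => //.
by rewrite addye// mulry gtr0_sg// mul1e.
Qed.

Lemma exchange_incr W k k' : exchange W k k' k = W k + 1.
Proof. by rewrite ffunE eqxx. Qed.

Lemma exchange_decr W k k' : k != k' -> exchange W k k' k' = W k' - 1.
Proof. by rewrite ffunE eq_sym eqxx => /negbTE ->. Qed.

Lemma exchange_other W k k' i : i != k -> i != k' -> exchange W k k' i = W i.
Proof. by rewrite ffunE => /negbTE -> /negbTE ->. Qed.

Lemma eq_eps W V i d : W i = V i -> eps W i d = eps V i d.
Proof. by rewrite /Defs.eps => ->. Qed.

Lemma finite_loop_iter W k k' V : finite_state W ->
  loop_iter p Z g W k k' V -> finite_state V.
Proof.
move=> fW [kk' _ neg ->] i; have [fk fk'] := exchange_cost_fin _ _ _ fW neg.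
have [->|ik] := eqVneq i k.
  exact: eps_fin_step fW (exchange_incr _ _ _) fk.
have [->|ik'] := eqVneq i k'.
  exact: eps_fin_step fW (exchange_decr _ _ _ kk') fk'.
by rewrite exchange_other.
Qed.

(* The constraint that the two indices differ does not matter: exchanging an
   index with itself has nonnegative cost. *)
Lemma loop_iter_argmin W k k' V i : finite_state W ->
  loop_iter p Z g W k k' V -> (eps W k 1 <= eps W i 1)%E.
Proof.
move=> fW [kk' kmin neg _]; have [_ fk'] := exchange_cost_fin _ _ _ fW neg.
rewrite -(@leeD2rE _ (eps W k' (-1)))//.
have [->|ik'] := eqVneq i k'; last exact: kmin.
exact: le_trans (ltW neg) (eps_incr_decr_ge0 _ _ fW).
Qed.

(** For [i = k] convexity applies, and for an untouched [i] the minimality of [k]. For [i = k'],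
    undoing the decrement costs at least [- eps W k' (-1)], which exceeds [eps W k 1] because the
    exchange had negative cost. *)
Lemma loop_iter_min_incr W k k' V i : finite_state W ->
  loop_iter p Z g W k k' V -> (eps W k 1 <= eps V i 1)%E.
Proof.
move=> fW WV; have imin := loop_iter_argmin _ _ _ _ i fW WV.
have [kk' _ neg VE] := WV; have [fk fk'] := exchange_cost_fin _ _ _ fW neg.
have [ik|ik] := eqVneq i k.
  by apply: le_trans imin _; apply: eps_incr; rewrite // VE ik exchange_incr.
have [ik'|ik'] := eqVneq i k'; last first.
  by rewrite (eq_eps V W)// VE exchange_other.
have := eps_reverse W V k' (-1) fW.
rewrite VE exchange_decr// opprK -VE ik' => /(_ erefl).
rewrite ltey_eq fk' => /(_ isT); move: neg; rewrite /exchange_cost.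
case: (eps W k 1) fk => // r _; case: (eps W k' (-1)) fk' => // s _.
case: (eps V k' 1) => [t| |] //; last by move=> *; exact: leey.
by rewrite lte_fin !lee_fin; lra.
Qed.
End marginals.

(** * Invariant along a run *)

Theorem theorem4p13 (R : realType) (n : nat) (p : 'I_n -> R) (Z : nat)
  (g : R -> R)
  (p_gt0 : forall i : 'I_n, 0 < p i) (p_sum1 : \sum_(i < n) p i = 1)
  (Z_gt0 : (0 < Z)%N)
  (g_convex : convex_function (`]0, +oo[ : set R) g) (g1 : g 1 = 0)
  (T : nat) (M : nat -> {ffun 'I_n -> int}) (j j' : nat -> 'I_n)
  (M_run : loop_run p Z g T M j j') :
  ~ exists (k : 'I_n) (s t : nat),
      [/\ (s < t)%N, (t < T)%N, j s = k & j' t = k].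
Proof.
move=> [k [s [t [st tT jk j'k]]]]; have [M0 Mstep] := M_run.
have fM r : (r <= T)%N -> finite_state p Z g (M r).
  elim: r => [_|r IH rT]; first by rewrite M0; exact: finite_init.
  exact: finite_loop_iter (IH (ltnW rT)) (Mstep r rT).
pose mu r := eps p Z g (M r) (j r) 1.
have mu_incr r : (r.+1 < T)%N -> (mu r <= mu r.+1)%E.
  move=> rT; have rT' := ltnW rT.
  exact: loop_iter_min_incr (fM r (ltnW rT')) (Mstep r rT').
have undo_incr r : (r < T)%N -> j r = k ->
    (0 <= mu r + eps p Z g (M r.+1) k (-1))%E.
  move=> rT jr; have [_ _ neg ME] := Mstep r rT.
  have fr := fM r (ltnW rT).
  have [e_fin _] := exchange_cost_fin _ _ _ p_gt0 Z_gt0 g_convex _ _ _ fr neg.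
  rewrite /mu jr; apply: eps_reverse => //; first by rewrite ME jr exchange_incr.
  by rewrite ltey_eq -jr e_fin.
(* Since [mu] does not decrease, an exchange decrementing [k] at iteration [r.+1] would inherit this
   nonnegative lower bound. *)
have no_decr r : (r.+1 < T)%N ->
    (0 <= mu r + eps p Z g (M r.+1) k (-1))%E -> j' r.+1 != k.
  move=> rT undo; have [_ _ neg _] := Mstep _ rT; apply/eqP => j'r.
  move: neg; rewrite /exchange_cost j'r ltNge (le_trans undo)//.
  by rewrite leeD2r// mu_incr.
(* Induction from [s]: if iteration [r.+1] increments [k], the bound is renewed by [undo_incr];
   otherwise [no_decr] shows that [k] is untouched, so its decrement cost is unchanged while [mu]
   has not dropped. *)
have undo_ge0 r : (s <= r)%N -> (r < T)%N ->
    (0 <= mu r + eps p Z g (M r.+1) k (-1))%E.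
  elim: r => [|r IH].
    by rewrite leqn0 => /eqP s0 rT; apply: undo_incr => //; rewrite -s0.
  rewrite leq_eqVlt => /predU1P[<-|sr] rT.
    by apply: undo_incr => //; rewrite (leq_ltn_trans _ tT)// ltnW.
  have [jr|jr] := eqVneq (j r.+1) k; first exact: undo_incr.
  have undo := IH sr (ltnW rT); have j'r := no_decr r rT undo.
  have [_ _ _ ME] := Mstep _ rT.
  rewrite (@eq_eps _ _ _ _ _ _ (M r.+1)); last first.
    by rewrite ME exchange_other// eq_sym.
  by rewrite (le_trans undo)// leeD2r// mu_incr.
case: t st tT j'k => // r; rewrite ltnS => sr rT.
by move/eqP; apply/negP/no_decr/undo_ge0 => //; exact: ltnW.
Qed.
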